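(* Let $\mathcal{I}$ be an ideal on $\mathbb{N}$ with the Baire property. Then there is a rich abstract upper density $\delta$ such that $\mathcal{Z}_\delta=\mathcal{I}$.
   Context: An abstract upper density on $\mathbb{N}$ is a function $\delta:\mathcal{P}(\mathbb{N})\to[0,1]$ such that $\delta(\mathbb{N})=1$; $\delta(F)=0$ for every finite $F\subseteq\mathbb{N}$; $A\subseteq B$ implies $\delta(A)\le\delta(B)$; and $\delta(A\cup B)\le\delta(A)+\delta(B)$. It is rich if for every $r\in[0,1]$ there is $A\subseteq\mathbb{N}$ with $\delta(A)=r$. $\mathcal{Z}_\delta=\{A\subseteq\mathbb{N}:\delta(A)=0\}$. An ideal on $\mathbb{N}$ is a family $\mathcal{I}\subseteq\mathcal{P}(\mathbb{N})$ closed under finite unions and subsets, containing all finite subsets of $\mathbb{N}$, with $\mathbb{N}\notin\mathcal{I}$. Subsets of $\mathbb{N}$ are identified with their characteristic functions, so $\mathcal{P}(\mathbb{N})$ carries the topology of the Cantor space $\{0,1\}^{\mathbb{N}}$; $\mathcal{I}$ has the Baire property if it has the Baire property as a subset of this space (i.e. there is an open $U$ such that the symmetric difference of $\mathcal{I}$ and $U$ is of first category). *)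

(* Defs.v *)
From HB Require Import structures.
From mathcomp Require Import all_boot all_order all_algebra.
From mathcomp Require Import all_classical all_reals all_analysis.
Set Implicit Arguments.
Unset Strict Implicit.
Unset Printing Implicit Defensive.
Import Order.TTheory GRing.Theory Num.Theory.
Local Open Scope classical_set_scope.
Local Open Scope ring_scope.

Definition nowhere_dense (T : topologicalType) (A : set T) : Prop :=
  interior (closure A) = set0.

Definition first_category (T : topologicalType) (A : set T) : Prop :=
  exists F : nat -> set T,
    (forall n, nowhere_dense (F n)) /\ A = \bigcup_n F n.

Definition Baire_property (T : topologicalType) (A : set T) : Prop :=
  exists U : set T, open U /\ first_category (A `+` U).

Definition char_fun (A : set nat) : cantor_space := fun n => `[< A n >].

(* [char_fun] is a bijection from [set nat] onto [cantor_space]; a family of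
   subsets of [nat] is viewed in the Cantor space as its direct image. *)
Definition family_Baire_property (I : set (set nat)) : Prop :=
  Baire_property (char_fun @` I).

Definition is_ideal (I : set (set nat)) : Prop :=
  [/\ forall A B, I A -> I B -> I (A `|` B),
      forall A B, A `<=` B -> I B -> I A,
      forall F, finite_set F -> I F
    & ~ I setT].

Definition abstract_upper_density (R : realType) (d : set nat -> R) : Prop :=
  [/\ forall A, 0 <= d A <= 1,
      d setT = 1,
      forall F, finite_set F -> d F = 0,
      forall A B, A `<=` B -> d A <= d B
    & forall A B, d (A `|` B) <= d A + d B].

Definition rich (R : realType) (d : set nat -> R) : Prop :=
  forall r : R, 0 <= r <= 1 -> exists A, d A = r.

Definition zero_sets (R : realType) (d : set nat -> R) : set (set nat) :=
  [set A | d A = 0].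

(* Main.v *)
(** A meager family is avoided by every point that agrees with a fixed [z] on
    infinitely many blocks of a suitable partition of [nat] into intervals.
    If an ideal [I] were comeager in a cylinder, two of its members would
    agree with [z] on the even and on the odd blocks respectively, and contain
    everything else outside a finite set; their union would be cofinite. So
    [I] is meager, and a set containing infinitely many blocks is not in [I]
    (Jalali-Naini, Talagrand).

    Let [g : nat -> (0, 1]] be constant on blocks and take values in each
    [(a, b]] on infinitely many blocks. The density of [A] is the limsup of
    [g] along [A] modulo [I], except that it is [1] when [0] is an [I]-cluster
    value of [g] along [A]. It is even max-subadditive, it vanishes exactly on
    [I], and [{r / 2 < g <= r}] has density [r]. *)

Require Import Defs.
From HB Require Import structures.
From mathcomp Require Import all_boot all_order all_algebra.
From mathcomp Require Import all_classical all_reals all_analysis.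
From mathcomp Require Import zify lra.
Set Implicit Arguments.
Unset Strict Implicit.
Unset Printing Implicit Defensive.
Import Order.TTheory GRing.Theory Num.Theory.
Local Open Scope classical_set_scope.

(** * Cylinders and meager sets in the Cantor space *)

Definition eq_between (m n : nat) (x y : cantor_space) : Prop :=
  forall i, m <= i < n -> x i = y i.

Lemma nbhs_cantorP (x : cantor_space) (V : set cantor_space) :
  nbhs x V -> exists n, eq_between 0 n x `<=` V.
Proof.
pose F : set_system cantor_space :=
  filter_from setT (fun n => eq_between 0 n x).
have FF : Filter F.
  apply: filter_from_filter; first by exists 0.
  move=> m n _ _; exists (maxn m n) => // y xy.
  by split=> i ilt; apply: xy; lia.
suff : F --> x by move=> /[apply] -[n _ nV]; exists n.
apply/cvg_sup => i A /= [_ [[B Bop <-] Bx BA]].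
by exists i.+1 => // y xy; apply: BA; rewrite /= -xy //; lia.
Qed.

Lemma eq_between_open (x : cantor_space) (n : nat) : open (eq_between 0 n x).
Proof.
elim: n => [|n IHn].
  rewrite (_ : eq_between 0 0 x = setT); first exact: openT.
  by apply/seteqP; split=> // y _ i; lia.
rewrite (_ : eq_between 0 n.+1 x =
  eq_between 0 n x `&` (fun y : cantor_space => y n) @^-1` [set x n]).
  apply: openI => //; apply: open_comp; last exact: discrete_open.
  by move=> y _; exact: (@proj_continuous nat (fun=> bool) n).
apply/seteqP; split=> [y xy|y [xy yn] i].
  by split=> [i ilt|]; [apply: xy; lia|symmetry; apply: xy; lia].
by rewrite /= ltnS leq_eqVlt => /orP[/eqP->//|ilt]; apply: xy.
Qed.

(** The open cylinder of [x] does not lie inside the closure of [F], so one of its points has a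
    cylinder missing [F]. *)
Lemma nowhere_dense_avoid (F : set cantor_space) (x : cantor_space) (n : nat) :
  nowhere_dense F ->
  exists m (y : cantor_space), [/\ n <= m, eq_between 0 n x y
    & forall w, eq_between 0 m y w -> ~ F w].
Proof.
move=> F0; have : ~ eq_between 0 n x `<=` closure F.
  move=> /interiorS; rewrite F0 => /(_ x); apply.
  by apply: open_nbhs_nbhs; split=> //; exact: eq_between_open.
move=> /existsNP[y /not_implyP[xy /existsNP[V /not_implyP[yV FV]]]].
have [m mV] := nbhs_cantorP yV.
exists (maxn m n), y; split=> //; first by lia.
move=> w yw Fw; apply: FV; exists w; split=> //; apply: mV => i ilt.
by apply: yw; lia.
Qed.

(** A pair in [s] is a finite prefix with the index of a set to avoid. The pairs are treated in
    turn, each prolonging the pattern [z] found so far, so earlier avoidance persists. *)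
Lemma nowhere_dense_avoid_seq (F : nat -> set cantor_space) (n : nat)
    (s : seq (seq bool * nat)) : (forall k, nowhere_dense (F k)) ->
  exists m (z : cantor_space), n < m /\ forall p, p \in s ->
    forall w : cantor_space,
    eq_between 0 n (nth false p.1) w -> eq_between n m z w -> ~ F p.2 w.
Proof.
move=> Fnd; elim: s => [|p s [m [z [nm IHs]]]].
  by exists n.+1, xpredT.
pose x : cantor_space := fun i => if i < n then nth false p.1 i else z i.
have [m' [y [mm' xy yF]]] := nowhere_dense_avoid x m (Fnd p.2).
exists m', y; split=> [|q]; first by lia.
rewrite inE => /orP[/eqP->|qs] w pw yw.
  apply: yF => i ilt; have [iltn|nlei] := ltnP i n; last by apply: yw; lia.
  by rewrite -pw // -xy; [rewrite /x iltn|lia].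
apply: (IHs _ qs) => // i ilt; rewrite -yw; last by lia.
by rewrite -xy; [rewrite /x ifN //; lia|lia].
Qed.

Lemma nowhere_dense_avoid_block (F : nat -> set cantor_space) (n k : nat) :
  (forall k, nowhere_dense (F k)) ->
  exists m (z : cantor_space), n < m /\ forall j, j <= k ->
    forall w : cantor_space, eq_between n m z w -> ~ F j w.
Proof.
move=> Fnd.
(* All prefixes of length [n] are listed, so the pattern works whatever [w] does below [n]. *)
pose s := [seq (val t, j) | t <- enum {: n.-tuple bool}, j <- iota 0 k.+1].
have [m [z [nm zF]]] := nowhere_dense_avoid_seq n s Fnd.
exists m, z; split=> // j jk w zw.
pose t := [tuple w i | i < n].
apply: (zF (val t, j)) => //.
  by apply: allpairs_f; rewrite ?mem_enum// mem_iota; lia.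
move=> i /= iltn; rewrite (_ : i = Ordinal iltn)//.
by rewrite -[RHS](tnth_mktuple (fun i : 'I_n => w i)) (tnth_nth false).
Qed.

Lemma strict_incr_between_inj (N : nat -> nat) (i k l : nat) :
  (forall k, N k < N k.+1) ->
  N k <= i < N k.+1 -> N l <= i < N l.+1 -> k = l.
Proof.
move=> Nlt ik il.
have Nle : {homo N : x y / x <= y}.
  by apply: homo_leq => // [?|x]; [exact: leq_trans|exact: ltnW].
have [kl|lk|//] := ltngtP k l; [have := Nle _ _ kl|have := Nle _ _ lk]; lia.
Qed.

(** Block [k] avoids [F 0], ..., [F k] at once, so agreement on one block of index at least [j]
    keeps [w] out of [F j]. Starting at [n0] leaves room for a prescribed prefix. *)
Lemma first_category_blocks (M : set cantor_space) (n0 : nat) :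
  first_category M ->
  exists (N : nat -> nat) (z : cantor_space),
    [/\ N 0 = n0, forall k, N k < N k.+1
    & forall w, (forall K, exists2 k, K <= k & eq_between (N k) (N k.+1) z w) ->
        ~ M w].
Proof.
move=> [F [Fnd ->]].
have /(_ _)/cid-/all_sig[m] : forall p : nat * nat,
    exists m (z : cantor_space), p.1 < m /\ forall j, j <= p.2 ->
      forall w : cantor_space, eq_between p.1 m z w -> ~ F j w.
  by move=> [n k]; exact: nowhere_dense_avoid_block.
move=> /(_ _)/cid-/all_sig[z mz].
pose N := fix N k := if k is k'.+1 then m (N k', k') else n0.
have Nlt k : N k < N k.+1 by have [] := mz (N k, k).
pose Z : cantor_space := fun i =>
  `[< exists k, N k <= i < N k.+1 /\ z (N k, k) i >].
exists N, Z; split=> // w wZ [j _ Fw].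
have [k jk Zw] := wZ j.
have [_ /(_ j jk w)] := mz (N k, k); apply => // i ilt.
rewrite -Zw //; apply/idP/asboolP => [zi|[l [il zl]]]; first by exists k.
by rewrite (strict_incr_between_inj Nlt ilt il).
Qed.

(** * Ideals with the Baire property *)

Lemma char_fun_image (I : set (set nat)) (x : cantor_space) :
  (char_fun @` I) x <-> I [set i | x i].
Proof.
split=> [[A IA <-]|Ix].
  suff -> : [set i | char_fun A i] = A by [].
  by apply/seteqP; split=> i /=; rewrite /char_fun => /asboolP.
by exists [set i | x i] => //; apply/funext => i; rewrite /char_fun /= asboolb.
Qed.

Lemma ideal_Baire_first_category (I : set (set nat)) :
  is_ideal I -> family_Baire_property I -> first_category (char_fun @` I).
Proof.
move=> [IU Isub Ifin IT] [U [Uop UM]].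
have [U0|/set0P[u Uu]] := eqVneq U set0.
  by move: UM; rewrite U0 setY0.
have [n0 n0U] := nbhs_cantorP (open_nbhs_nbhs (conj Uop Uu)).
have [N [z [N0 Nlt Nz]]] := first_category_blocks n0 UM.
(* [X b] starts like [u], copies [z] on the blocks of parity [b] and is true on all the others. *)
pose X (b : bool) : cantor_space := fun i => if i < n0 then u i else
  `[< forall k, N k <= i < N k.+1 -> odd k = b -> z i >].
have Nle k : n0 <= N k.
  by elim: k => [|k]; [rewrite N0|have := Nlt k; lia].
have IX b : I [set i | X b i].
  apply/char_fun_image; apply: contrapT => nIX; apply: (Nz (X b)).
    move=> K; exists (K.*2 + b); first lia.
    move=> i ilt; rewrite /X ifN; last by have := Nle (K.*2 + b); lia.
    apply/idP/asboolP => [//|]; apply; first exact: ilt.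
    by rewrite oddD odd_double; case: b {nIX ilt}.
  (* Outside the ideal, [X b] would lie in the meager symmetric difference, which [Nz] excludes. *)
  right; split=> //; apply: n0U => i /= ilt.
  by rewrite /X ilt.
exfalso; apply: IT.
have -> : setT = `I_n0 `|` ([set i | X true i] `|` [set i | X false i]).
  apply/esym/seteqP; split=> // i _.
  have [ilt|nlei] := ltnP i n0; [by left|right].
  (* A point past [n0] missed by both sets would lie in an odd and in an even block. *)
  apply: contrapT => /not_orP[]; rewrite /= /X !ifN; [|lia|lia].
  move=> /negP/asboolPn/existsNP[k /not_implyP[ik /not_implyP[ok _]]].
  move=> /negP/asboolPn/existsNP[l /not_implyP[il /not_implyP[ol _]]].
  by move: ok; rewrite (strict_incr_between_inj Nlt ik il) ol.
by apply: (IU) (IU _ _ (IX true) (IX false)); exact/Ifin/finite_II.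
Qed.

Lemma ideal_Baire_blocks (I : set (set nat)) :
  is_ideal I -> family_Baire_property I ->
  exists f : nat -> nat, forall A,
    (forall K, exists2 k, K <= k & f @^-1` [set k] `<=` A) -> ~ I A.
Proof.
move=> idI BI; have Isub : forall A B, A `<=` B -> I B -> I A by case: idI.
have [N [z [N0 Nlt Nz]]] :=
  first_category_blocks 0 (ideal_Baire_first_category idI BI).
have /choice[f fN] : forall i, exists k, N k <= i < N k.+1.
  elim=> [|i [k ik]]; first by exists 0; have := Nlt 0; lia.
  have [?|?] := ltnP i.+1 (N k.+1); first by exists k; lia.
  by exists k.+1; have := Nlt k.+1; lia.
exists f => A fA IA.
(* The trace of [z] on [A] agrees with [z] on every block inside [A], yet it is a subset of [A]. *)
apply: (Nz (fun i => `[< A i >] && z i)).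
  move=> K; have [k Kk kA] := fA K; exists k => // i ik.
  have /kA : (f @^-1` [set k]) i.
    exact: strict_incr_between_inj Nlt (fN i) ik.
  by move=> /asboolP->.
by apply/char_fun_image; apply: Isub IA => i /andP[/asboolP].
Qed.

(** * A sequence dense in the unit interval *)

Local Open Scope ring_scope.

Lemma dense_sequence (R : realType) : exists h : nat -> R,
  (forall k, 0 < h k <= 1) /\
  forall a b, 0 <= a -> a < b -> b <= 1 ->
    forall K, exists2 k, (K <= k)%N & a < h k <= b.
Proof.
(* Pairing each rational with a natural number makes it recur at arbitrarily large indices; the
   default [1] keeps the values positive and at most [1]. *)
pose h k : R := if @unpickle (rat * nat)%type k is Some (q, _) then
  (let x := @ratr R q in if 0 < x <= 1 then x else 1) else 1.
exists h; split=> [k|a b a0 ab b1 K].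
  rewrite /h; case: unpickle => [[q _]|]; last by rewrite ltr01 lexx.
  by rewrite /=; case: ifP => //; rewrite ltr01 lexx.
have [q] := rat_in_itvoo ab; rewrite in_itv => /= /andP[aq qb].
have [m Km] : exists m, (K <= pickle (q, m : nat))%N.
  (* Pigeonhole: otherwise [K.+1] distinct codes would lie below [K]. *)
  apply: contrapT => /forallNP mK.
  have mK' m : (pickle (q, m : nat) < K)%N.
    by have /negP := mK m; rewrite -ltnNge.
  pose p (m : 'I_K.+1) : 'I_K := Ordinal (mK' m).
  have /leq_card : injective p.
    move=> m1 m2 /(congr1 val)/= /(pcan_inj pickleK)[?]; exact: val_inj.
  by rewrite !card_ord ltnn.
exists (pickle (q, m)) => //; rewrite /h pickleK /= ifT; lra.
Qed.

(** * The limsup density modulo an ideal *)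

Section density.
Context (R : realType) (I : set (set nat)) (g : nat -> R).
Context (idI : is_ideal I) (g01 : forall i, 0 < g i <= 1).

(** As [g] is positive, this expresses that [0] is a cluster value of [g] along [A] modulo [I]. *)
Definition small_values (A : set nat) : Prop :=
  forall e, 0 < e -> ~ I (A `&` [set i | g i < e]).

(* Without the first case, a set outside [I] along which [g] tends to [0] would
   have density [0]. *)
Definition limsup_density (A : set nat) : R :=
  if `[< small_values A >] then 1
  else inf [set t | 0 <= t /\ I (A `&` [set i | t < g i])].

Let IU A B : I A -> I B -> I (A `|` B).
Proof. by case: idI => + _ _ _; apply. Qed.

Let Isub A B : A `<=` B -> I B -> I A.
Proof. by case: idI => _ + _ _; apply. Qed.

Let I0 : I set0. Proof. by case: idI => _ _ + _; apply. Qed.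

Let levels A := [set t | 0 <= t /\ I (A `&` [set i | t < g i])].

Let levels1 A : levels A 1.
Proof.
split=> //; apply: Isub I0 => i [_ /=]; have /andP[_] := g01 i; lra.
Qed.

Let levels_neq0 A : levels A !=set0. Proof. by exists 1; exact: levels1. Qed.

Let levels_lb A : lbound (levels A) 0. Proof. by move=> t []. Qed.

Lemma limsup_density_ge0 A : 0 <= limsup_density A.
Proof.
rewrite /limsup_density; case: asbool => //.
by apply: lb_le_inf; [exact: levels_neq0|exact: levels_lb].
Qed.

Let inf_levels_le A t : levels A t -> inf (levels A) <= t.
Proof. by apply: ge_inf; exists 0; exact: levels_lb. Qed.

Lemma limsup_density_le1 A : limsup_density A <= 1.
Proof.
by rewrite /limsup_density; case: asbool => //; exact: inf_levels_le.
Qed.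

Lemma small_valuesS A B : A `<=` B -> small_values A -> small_values B.
Proof.
move=> AB sA e /sA nI IB; apply: nI; apply: Isub IB; exact: setSI.
Qed.

(** If the condition fails for [A] at [e] and for [B] at [e'], it fails for the union at their
    minimum. *)
Lemma small_valuesU A B : small_values (A `|` B) ->
  small_values A \/ small_values B.
Proof.
move=> sAB; apply: contrapT => /not_orP[].
move=> /existsNP[e /not_implyP[e0 /contrapT IA]].
move=> /existsNP[e' /not_implyP[e'0 /contrapT IB]].
apply: (sAB (Num.min e e')); first by rewrite lt_min e0.
apply: Isub (IU IA IB) => i [ABi] /=; rewrite lt_min => /andP[ie ie'].
by case: ABi; [left|right].
Qed.

Lemma limsup_densityS A B : A `<=` B -> limsup_density A <= limsup_density B.
Proof.
move=> AB; rewrite {2}/limsup_density; case: asboolP => sB.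
  exact: limsup_density_le1.
rewrite /limsup_density asboolF; last by move=> /(small_valuesS AB).
apply: lb_le_inf => [|t [t0 It]]; first exact: levels_neq0.
by apply: inf_levels_le; split=> //; apply: Isub It; exact: setSI.
Qed.

(** Away from the exceptional case, the maximum of a level of [A] and a level of [B] is a level of
    the union. *)
Lemma limsup_densityU A B :
  limsup_density (A `|` B) <= Num.max (limsup_density A) (limsup_density B).
Proof.
rewrite {1}/limsup_density; case: asboolP => [/small_valuesU|sAB].
  by rewrite le_max /limsup_density => -[] /asboolP ->; rewrite lexx ?orbT.
have sA : ~ small_values A by move=> /(small_valuesS (@subsetUl _ A B)).
have sB : ~ small_values B by move=> /(small_valuesS (@subsetUr _ A B)).
rewrite {1}/limsup_density asboolF// {1}/limsup_density asboolF//.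
apply/ler_addgt0Pr => e e0.
have [|s [s0 Is] se] := @inf_adherent _ (levels A) e e0.
  by split; [exact: levels_neq0|exists 0; exact: levels_lb].
have [|t [t0 It] te] := @inf_adherent _ (levels B) e e0.
  by split; [exact: levels_neq0|exists 0; exact: levels_lb].
apply: (@le_trans _ _ (Num.max s t)); last first.
  by rewrite addr_maxl ge_max !le_max (ltW se) (ltW te) orbT.
apply: inf_levels_le; split; first by rewrite le_max s0.
apply: Isub (IU Is It) => i [ABi] /=; rewrite gt_max => /andP[si ti].
by case: ABi; [left|right].
Qed.

(** Density [0] rules out the exceptional case, so the part of [A] with [g < e] is in [I] for some
    [e]; a level [t < e] puts the rest in [I]. *)
Lemma limsup_density_eq0 A : limsup_density A = 0 <-> I A.
Proof.
split=> [|IA].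
  rewrite /limsup_density; case: asboolP => [_ /eqP|].
    by rewrite oner_eq0.
  move=> /existsNP[e /not_implyP[e0 /contrapT Ie]] inf0.
  have [t [t0 It] te] : exists2 t, levels A t & t < e.
    by apply: inf_lt (levels_neq0 A) _; rewrite inf0.
  apply: Isub (IU Ie It) => i Ai.
  have [ti|it] := ltP t (g i); [by right|left; split=> //=].
  exact: le_lt_trans te.
apply/eqP; rewrite eq_le limsup_density_ge0 andbT /limsup_density asboolF.
  by apply: inf_levels_le; split=> //; apply: Isub IA.
by move=> /(_ 1 ltr01); apply; apply: Isub IA.
Qed.

Lemma abstract_upper_density_limsup : limsup_density setT = 1 ->
  abstract_upper_density limsup_density.
Proof.
move=> dT; split=> // [A|F Ffin|A B|A B].
- by rewrite limsup_density_ge0 limsup_density_le1.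
- by apply/limsup_density_eq0; case: idI => _ _ + _; apply.
- exact: limsup_densityS.
- apply: le_trans (limsup_densityU A B) _.
  by rewrite ge_max lerDl lerDr !limsup_density_ge0.
Qed.

(** The cut at [r / 2] keeps [g] away from [0], and a level [t < r] would put a whole band of values
    just below [r] in [I]. *)
Lemma limsup_density_halfopen (r : R) : 0 < r ->
  (forall a, 0 <= a -> a < r -> ~ I [set i | a < g i <= r]) ->
  limsup_density [set i | r / 2 < g i <= r] = r.
Proof.
move=> r0 Ir; rewrite /limsup_density asboolF; last first.
  move=> /(_ (r / 2)) []; first lra.
  by apply: Isub I0 => i [/andP[+ _]] /=; lra.
apply/eqP; rewrite eq_le; apply/andP; split.
  apply: inf_levels_le; split; first exact: ltW.
  by apply: Isub I0 => i [/andP[_ +]] /=; lra.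
apply: lb_le_inf => [|t [t0 It]]; first exact: levels_neq0.
rewrite leNgt; apply/negP => tr.
apply: (Ir (Num.max t (r / 2))).
- by rewrite le_max t0.
- by rewrite gt_max tr /=; lra.
- apply: Isub It => i /= /andP[]; rewrite gt_max => /andP[ti ri] ir.
  by rewrite ri ir.
Qed.

End density.

Theorem theorem2p2 (R : realType) (I : set (set nat)) :
  is_ideal I -> family_Baire_property I ->
  exists d : set nat -> R,
    [/\ abstract_upper_density d, rich d & zero_sets d = I].
Proof.
move=> idI BI; have [f fI] := ideal_Baire_blocks idI BI.
have [h [h01 hdense]] := dense_sequence R.
pose g i := h (f i).
have g01 i : 0 < g i <= 1 by exact: h01.
(* Infinitely many whole blocks have their value of [g] in the interval. *)
have gI a b : 0 <= a -> a < b -> b <= 1 -> ~ I [set i | a < g i <= b].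
  move=> a0 ab b1; apply: fI => K.
  have [k Kk hk] := hdense _ _ a0 ab b1 K.
  by exists k => // i /= fik; rewrite /g fik.
have gr r : 0 < r -> r <= 1 ->
    limsup_density I g [set i | r / 2 < g i <= r] = r.
  by move=> r0 r1; apply: limsup_density_halfopen => // a a0 ar; apply: gI.
have dT : limsup_density I g setT = 1.
  (* The band of values above [1 / 2] already has density [1]. *)
  apply/eqP; rewrite eq_le limsup_density_le1//= -{1}(gr 1)//.
  exact: limsup_densityS.
exists (limsup_density I g); split.
- exact: abstract_upper_density_limsup.
- move=> r /andP[]; rewrite le_eqVlt => /predU1P[<- _|r0 r1].
    exists set0; apply/limsup_density_eq0 => //.
    by case: idI => _ _ + _; apply.
  by exists [set i | r / 2 < g i <= r]; exact: gr.
- by apply/seteqP; split=> A /=; rewrite /zero_sets /= limsup_density_eq0.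
Qed.
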